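(* Let $\mathbf x,\mathbf y$ be two different instances. If $P(\mathbf y\in I(\mathbf x))<1$, then $P(I(\mathbf x)\cap I(\mathbf y)=\emptyset)=1$, meaning: for every instance $\mathbf w$, $P(\mathbf w\in I(\mathbf x)\cap I(\mathbf y))=0$. Moreover, $$P(\mathbf y\in I(\mathbf x))=1\iff P(I(\mathbf x)=I(\mathbf y))=1,$$ where $P(I(\mathbf x)=I(\mathbf y))=1$ means: for every instance $\mathbf w$, $P(\mathbf w\in I(\mathbf x))=1$ if and only if $P(\mathbf w\in I(\mathbf y))=1$.
   Context: Setting: $n$ instances with covariates in $\mathbb R^d$ form the dataset $\mathcal D=\mathcal D_n$; a forest of $K$ axis-aligned causal trees is built on $\mathcal D$, the trees being independent given $\mathcal D$. $L_k(\mathbf u)$ is the leaf of tree $k$ containing $\mathbf u$ (each point lies in exactly one leaf of each tree). For instances $\mathbf u,\mathbf v$, $P(\mathbf u\in L(\mathbf v))$ denotes $P(\mathbf u\in L_k(\mathbf v)\mid\mathcal D)$ (same for all $k$), the events $\{\mathbf u\in L_k(\mathbf v)\}$, $k=1,\dots,K$, are independent given $\mathcal D$, and $\lim_{n\to\infty}P(\mathbf u\in L(\mathbf v))$ is assumed to exist for all pairs. LILI with $K$ trees: $\mathbf u\in I(\mathbf v,\Theta_K)$ iff the number of $k\le K$ with $\mathbf u\in L_k(\mathbf v)$ exceeds $K-\sqrt K$. All probabilities of events involving $I(\cdot)$ are conditional on $\mathcal D$ and defined as $\lim_{K\to\infty}\lim_{n\to\infty}$ of the corresponding probabilities with $I(\cdot,\Theta_K)$,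 e.g. $P(\mathbf u\in I(\mathbf v)):=\lim_{K}\lim_{n}P(\mathbf u\in I(\mathbf v,\Theta_K)\mid\mathcal D_n)$ and $P(\mathbf w\in I(\mathbf x)\cap I(\mathbf y)):=\lim_K\lim_nP(\mathbf w\in I(\mathbf x,\Theta_K)\cap I(\mathbf y,\Theta_K)\mid\mathcal D_n)$. *)

(* Defs.v *)
From HB Require Import structures.
From mathcomp Require Import all_boot all_order all_algebra.
From mathcomp Require Import all_classical all_reals all_analysis.
Set Implicit Arguments. Unset Strict Implicit. Unset Printing Implicit Defensive.
Import Order.TTheory GRing.Theory Num.Theory.
Import numFieldNormedType.Exports.
Local Open Scope classical_set_scope.
Local Open Scope ring_scope.

(* Setting.
   - instances are points of 'rV[R]_dim;
   - for each sample size n, [P n] is the (conditional on D_n) probability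
     governing the randomness of the forest;
   - [leaf n k w u] is the label of the leaf of tree k (built on D_n) that
     contains instance u, in outcome w; so every point lies in exactly one leaf
     of each tree, and  u \in L_k(v)  iff  leaf n k w u = leaf n k w v. *)

Section Defs.
Context {R : realType} {dim : nat} {d : measure_display} {Omega : measurableType d}
        {Lf : eqType}.
Variable leaf : nat -> nat -> Omega -> 'rV[R]_dim -> Lf.

Definition inLeaf (n k : nat) (u v : 'rV[R]_dim) : set Omega :=
  [set w | leaf n k w u = leaf n k w v].

Definition leafCount (n K : nat) (u v : 'rV[R]_dim) (w : Omega) : nat :=
  #|[set k : 'I_K | leaf n k w u == leaf n k w v]|.

(* the LILI event  u \in I(v, Theta_K)  : count exceeds K - sqrt K *)
Definition inLILI (n K : nat) (u v : 'rV[R]_dim) : set Omega :=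
  [set w | (K%:R - Num.sqrt (K%:R)) < (leafCount n K u v w)%:R :> R].
End Defs.

Definition mutually_independent {R : realType} {d : measure_display}
  {Omega : measurableType d} (P : probability Omega R) (E : nat -> set Omega) :=
  forall s : seq nat, uniq s ->
    fine (P (\big[setI/setT]_(k <- s) E k)) = \prod_(k <- s) fine (P (E k)).

Definition Plim {R : realType} {d : measure_display} {Omega : measurableType d}
  (P : nat -> probability Omega R) (E : nat -> nat -> set Omega) : R :=
  limn (fun K : nat => limn (fun n : nat => fine (P n (E n K)))).

(* Main.v *)
Require Import Defs.
From HB Require Import structures.
From mathcomp Require Import all_boot all_order all_algebra.
From mathcomp Require Import all_classical all_reals all_analysis.
From mathcomp Require Import zify lra.
Import Order.TTheory GRing.Theory Num.Theory.
Import numFieldNormedType.Exports.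
Local Open Scope classical_set_scope.
Local Open Scope ring_scope.

(* Let q_n = P(u in L(v) | D_n) tend to p. Membership u in I(v, Theta_K) means
   that fewer than sqrt K of the K independent trees separate u from v. Cutting
   the trees into isqrt K + 1 disjoint blocks of isqrt K - 1 consecutive trees,
   some block then has no separating tree, so
   P(u in I(v, Theta_K)) <= (isqrt K + 1) q_n ^ (isqrt K - 1), whose limit (first
   in n, then in K) is 0 when p < 1; when p = 1, P(u in I(v, Theta_K)) >= q_n ^ K
   tends to 1. So P(u in I(v)) is 1 if p(u,v) = 1 and 0 otherwise, and p = 1 is
   an equivalence relation (transitivity from P(A & B) >= P(A) + P(B) - 1), from
   which both claims follow. *)

Section fine_probability.
Context {d} {T : measurableType d} {R : realType} (P : probability T R).
Implicit Types A B : set T.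

Lemma fine_probabilityK A : measurable A -> (fine (P A))%:E = P A.
Proof.
move=> mA; rewrite fineK // ge0_fin_numE //.
by rewrite (le_lt_trans (probability_le1 P mA)) // ltry.
Qed.

Lemma fine_probability_le1 A : measurable A -> fine (P A) <= 1.
Proof. by move=> mA; rewrite -lee_fin fine_probabilityK ?probability_le1. Qed.

Lemma le_fine_probability A B :
  measurable A -> measurable B -> A `<=` B -> fine (P A) <= fine (P B).
Proof.
move=> mA mB AB; rewrite -lee_fin !fine_probabilityK //.
by apply: le_measure => //; rewrite inE.
Qed.

Lemma fine_probabilityI_ge A B : measurable A -> measurable B ->
  fine (P A) + fine (P B) - 1 <= fine (P (A `&` B)).
Proof.
move=> mA mB.
have mAB : measurable (A `\` B) by exact: measurableD.
have mI : measurable (A `&` B) by exact: measurableI.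
have splitA : fine (P A) = fine (P (A `\` B)) + fine (P (A `&` B)).
  by apply: EFin_inj; rewrite EFinD !fine_probabilityK //; apply: measureDI.
have diff_le : fine (P (A `\` B)) <= 1 - fine (P B).
  have -> : 1 - fine (P B) = fine (P (~` B)).
    by rewrite probability_setC // -fine_probabilityK.
  by apply: (le_fine_probability _ _ mAB (measurableC mB)) => w [].
lra.
Qed.

End fine_probability.

Lemma natmul_expr_le (R : realFieldType) (s : R) n :
  0 <= s < 1 -> n%:R * s ^+ n <= (1 - s)^-1.
Proof.
case/andP=> s0 s1; rewrite -div1r ler_pdivlMr ?subr_gt0 //.
have geom_sum : (\sum_(i < n) s ^+ i) * (1 - s) = 1 - s ^+ n.
  by rewrite -opprB mulrN -mulrC -subrX1 opprB.
have sum_ge : n%:R * s ^+ n <= \sum_(i < n) s ^+ i.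
  rewrite mulr_natl -[n in _ *+ n]card_ord -sumr_const.
  by apply: ler_sum => i _; apply: ler_wiXn2l => //; [exact: ltW | exact: ltnW].
apply: le_trans (ler_wpM2r _ sum_ge) _; first by rewrite subr_ge0 (ltW s1).
by rewrite geom_sum gerBl exprn_ge0.
Qed.

Lemma cvg_natmul_expr {R : realType} (p : R) :
  0 <= p < 1 -> (fun n => n%:R * p ^+ n) @ \oo --> 0.
Proof.
case/andP=> p0 p1; set s := Num.sqrt p.
have s01 : 0 <= s < 1 by rewrite sqrtr_ge0 -sqrtr1 ltr_sqrt.
have ps n : p ^+ n = s ^+ n * s ^+ n by rewrite -exprMn -expr2 sqr_sqrtr.
apply: (squeeze_cvgr (f := fun=> 0) (h := fun n => (1 - s)^-1 * s ^+ n)).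
- apply: nearW => n; rewrite mulr_ge0 ?exprn_ge0 //= ps mulrA.
  by rewrite ler_wpM2r ?exprn_ge0 ?natmul_expr_le // sqrtr_ge0.
- exact: cvg_cst.
- rewrite -(mulr0 (1 - s)^-1); apply: cvgM; first exact: cvg_cst.
  by apply: cvg_expr; rewrite ger0_norm ?sqrtr_ge0 //; case/andP: s01.
Qed.

(* A divergent [a] has [limn a = 0] by convention, which the bound covers. *)
Lemma limn_le_cvg (R : realType) (a b : R ^nat) (B : R) :
  (forall n, 0 <= a n <= b n) -> b @ \oo --> B -> 0 <= limn a <= B.
Proof.
move=> ab bB; have a_ge0 n : 0 <= a n by case/andP: (ab n).
have a_le n : a n <= b n by case/andP: (ab n).
have B_ge0 : 0 <= B.
  rewrite -(cvg_lim _ bB) //; apply: limr_ge; first exact: cvgP bB.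
  by apply: nearW => n; exact: le_trans (a_ge0 n) (a_le n).
have [a_cvg|a_dvg] := pselect (cvgn a); last by rewrite dvgP // lexx.
rewrite limr_ge //=; last exact: nearW.
rewrite -(cvg_lim _ bB) //; apply: ler_lim => //; first exact: cvgP bB.
exact: nearW.
Qed.

Lemma pigeonhole_blocks {K m L : nat} (good : pred nat) :
  (#|[pred k : 'I_K | ~~ good k]| <= m)%N -> (m.+1 * L <= K)%N ->
  exists2 i, (i < m.+1)%N & forall j, (j < L)%N -> good (i * L + j)%N.
Proof.
move=> few_bad mLK; apply: contrapT => no_block.
have bad_in (i : 'I_m.+1) : exists k : 'I_K, ~~ good k && (k %/ L == i)%N.
  have /existsNP [j /not_implyP [jL bad_j]] :
      ~ forall j, (j < L)%N -> good (i * L + j)%N.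
    by move=> all_good; apply: no_block; exists i.
  have kK : (i * L + j < K)%N by have := ltn_ord i; nia.
  have L_gt0 : (0 < L)%N by exact: leq_ltn_trans jL.
  exists (Ordinal kK); rewrite /= divnMDl // divn_small // addn0 eqxx andbT.
  exact/negP.
have [f fP] := choice bad_in.
have f_inj : injective f.
  move=> i1 i2 /(congr1 (fun k : 'I_K => k %/ L)%N).
  by case/andP: (fP i1) => _ /eqP ->; case/andP: (fP i2) => _ /eqP ->; apply: val_inj.
have : (#|f @: [set: 'I_m.+1]%SET| <= #|[pred k : 'I_K | ~~ good k]|)%N.
  apply/subset_leq_card/fintype.subsetP => _ /imsetP [i _ ->].
  by rewrite inE; case/andP: (fP i).
by rewrite card_imset // cardsT card_ord => /leq_trans /(_ few_bad); rewrite ltnn.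
Qed.

Definition isqrt (R : realType) (K : nat) : nat := Num.trunc (Num.sqrt (K%:R : R)).

Section isqrt.
Variable R : realType.

Lemma isqrt_sqr_le K : (isqrt R K * isqrt R K <= K)%N.
Proof.
rewrite -(ler_nat R) natrM -[leRHS](@sqr_sqrtr R K%:R) // expr2.
have := truncn_le (Num.sqrt (K%:R : R)); rewrite sqrtr_ge0 => le_sqrt.
by apply: ler_pM.
Qed.

Lemma sqrt_lt_isqrtS K : Num.sqrt (K%:R : R) < (isqrt R K).+1%:R.
Proof. exact: truncnS_gt. Qed.

Lemma cvg_isqrt : isqrt R @ \oo --> \oo.
Proof.
apply/cvgnyPge => M; exists (M * M)%N => // K /= MMK.
rewrite /isqrt truncn_ge_nat // -[M%:R](@ger0_norm R) // -sqrtr_sqr ler_sqrt //.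
by rewrite -natrX ler_nat expnS expn1.
Qed.

End isqrt.

Section forest.
Context {R : realType} {dim : nat} {d : measure_display} {Omega : measurableType d}
  {Lf : eqType} (P : nat -> probability Omega R)
  (leaf : nat -> nat -> Omega -> 'rV[R]_dim -> Lf).
Implicit Types (n k K : nat) (u v : 'rV[R]_dim).

Lemma inLeafC n k u v : inLeaf leaf n k u v = inLeaf leaf n k v u.
Proof. by rewrite /inLeaf; apply/seteqP; split => w /= ->. Qed.

Lemma inLeafxx n k u : inLeaf leaf n k u u = setT.
Proof. by apply/seteqP; split. Qed.

Lemma inLeaf_trans n k a b c :
  inLeaf leaf n k a b `&` inLeaf leaf n k b c `<=` inLeaf leaf n k a c.
Proof. by move=> w []; rewrite /inLeaf /= => -> ->. Qed.

Lemma leafCountE n K u v w :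
  (leafCount leaf n K u v w)%:R = \sum_(k < K) (\1_(inLeaf leaf n k u v) w : R).
Proof.
rewrite /leafCount -sum1_card natr_sum big_mkcond /=.
apply: eq_bigr => k _; rewrite indicE.
case: ifPn; rewrite ?in_setE ?notin_setE /= => hk.
  by rewrite mem_set //; apply/eqP.
by rewrite memNset //= => /eqP.
Qed.

Lemma leafCount_misses n K u v w :
  (leafCount leaf n K u v w
   + #|[pred k : 'I_K | ~~ (leaf n k w u == leaf n k w v)]|)%N = K.
Proof.
rewrite -[RHS]card_ord -(cardC [pred k : 'I_K | leaf n k w u == leaf n k w v]).
by congr (_ + _)%N; apply: eq_card => k; rewrite !inE; apply/idP/idP; rewrite in_setE.
Qed.

Hypothesis Hmeas : forall n k u v, measurable (inLeaf leaf n k u v).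

Lemma measurable_inLILI n K u v : measurable (inLILI leaf n K u v).
Proof.
pose count w := \sum_(k < K) (\1_(inLeaf leaf n k u v) w : R).
have mcount : measurable_fun setT count.
  by apply: measurable_sum => k; apply: measurable_realfun.measurable_indic.
rewrite (_ : inLILI _ _ _ _ _ = setT `&` count @^-1` `](K%:R - Num.sqrt K%:R), +oo[).
  exact: mcount measurableT _ (measurable_itv _).
by apply/seteqP; split => w; rewrite /= /count -leafCountE in_itv /= andbT // => -[].
Qed.

Local Notation blen K := (isqrt R K).-1.

Definition block K i := [seq i * blen K + j | j <- iota 0 (blen K)].

Definition inBlock n K u v i := \big[setI/setT]_(k <- block K i) inLeaf leaf n k u v.

Lemma inLILI_sub_blocks n K u v :
  inLILI leaf n K u v `<=`
  \big[setU/set0]_(i < (blen K).+2) inBlock n K u v i.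
Proof.
move=> w LILIw; rewrite -bigcup_mkord.
set misses := #|[pred k : 'I_K | ~~ (leaf n k w u == leaf n k w v)]|.
have misses_lt : misses%:R < (isqrt R K).+1%:R :> R.
  have := congr1 (fun m => m%:R : R) (leafCount_misses n K u v w); rewrite natrD.
  by move: LILIw (sqrt_lt_isqrtS R K); rewrite /inLILI /=; lra.
have few_misses : (misses <= (blen K).+1)%N.
  by rewrite -ltnS -(ltr_nat R) (lt_le_trans misses_lt) // ler_nat; case: (isqrt R K).
have blocks_fit : ((blen K).+2 * blen K <= K)%N.
  by apply: leq_trans (isqrt_sqr_le R K); case: (isqrt R K) => //= m; nia.
have [i i_lt all_good] :=
  pigeonhole_blocks (fun k => leaf n k w u == leaf n k w v) few_misses blocks_fit.
exists i => //.
rewrite /inBlock -bigcap_seq => k /mapP [j]; rewrite mem_iota add0n => j_lt ->.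
exact/eqP/all_good.
Qed.

Definition leafProb u v n := fine (P n (inLeaf leaf n 0 u v)).

Lemma leafProb_ge0 u v n : 0 <= leafProb u v n.
Proof. exact: fine_ge0. Qed.

Lemma leafProb_le1 u v n : leafProb u v n <= 1.
Proof. exact: fine_probability_le1. Qed.

Hypothesis Hsame : forall n k u v,
  P n (inLeaf leaf n k u v) = P n (inLeaf leaf n 0 u v).
Hypothesis Hindep : forall n u v,
  mutually_independent (P n) (fun k => inLeaf leaf n k u v).

Lemma prob_bigcap_inLeaf n u v (s : seq nat) : uniq s ->
  fine (P n (\big[setI/setT]_(k <- s) inLeaf leaf n k u v)) = leafProb u v n ^+ size s.
Proof.
move=> s_uniq; rewrite Hindep // (eq_bigr (fun=> leafProb u v n)) => [|k _].
  by rewrite (big_nth 0%N) prodr_const_nat subn0.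
by rewrite /leafProb Hsame.
Qed.

Lemma LILI_prob_le n K u v :
  fine (P n (inLILI leaf n K u v)) <= (blen K).+2%:R * leafProb u v n ^+ blen K.
Proof.
have mblock i : measurable (inBlock n K u v i).
  by apply: bigsetI_measurable => k _.
have block_prob i :
    P n (inBlock n K u v i) = (leafProb u v n ^+ blen K)%:E.
  rewrite -fine_probabilityK // prob_bigcap_inLeaf ?size_map ?size_iota //.
  by rewrite map_inj_uniq ?iota_uniq //; exact: addnI.
have munion : measurable (\big[setU/set0]_(i < (blen K).+2) inBlock n K u v i).
  by apply: bigsetU_measurable => i _.
rewrite -lee_fin fine_probabilityK; last exact: measurable_inLILI.
apply: le_trans (le_measure _ (mem_set (measurable_inLILI n K u v)) (mem_set munion)
  (inLILI_sub_blocks n K u v)) _.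
apply: le_trans (Boole_inequality (P n) (fun i _ => mblock i)) _.
rewrite (eq_bigr (fun=> (leafProb u v n ^+ blen K)%:E)) => [|i _]; last exact: block_prob.
by rewrite sumEFin sumr_const card_ord mulr_natl.
Qed.

Lemma Plim_LILI_sub_eq0 {u v p} {E : nat -> nat -> set Omega} :
  leafProb u v @ \oo --> p -> p < 1 ->
  (forall n K, measurable (E n K)) -> (forall n K, E n K `<=` inLILI leaf n K u v) ->
  Plim P E = 0.
Proof.
move=> q_p p_lt1 mE E_sub.
have p_ge0 : 0 <= p.
  rewrite -(cvg_lim _ q_p) //; apply: limr_ge; first exact: cvgP q_p.
  exact: nearW (leafProb_ge0 u v).
pose bound m := m%:R * p ^+ m + 2 * p ^+ m.
have boundE m : m.+2%:R * p ^+ m = bound m by rewrite /bound -mulrDl -natrD addn2.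
have bound_cvg : bound @ \oo --> 0.
  have p_norm : `|p| < 1 by rewrite ger0_norm.
  have p01 : 0 <= p < 1 by rewrite p_ge0 p_lt1.
  suff : bound @ \oo --> (0 + 2 * 0 : R) by rewrite mulr0 addr0.
  exact: cvgD (cvg_natmul_expr _ p01) (cvgM (cvg_cst _) (cvg_expr p_norm)).
have blen_cvg : (fun K => blen K) @ \oo --> \oo.
  by under eq_fun do rewrite -subn1; exact: cvg_comp (cvg_isqrt R) (cvg_subnr 1).
have E_lim K : 0 <= limn (fun n => fine (P n (E n K))) <= bound (blen K).
  apply: (@limn_le_cvg _ _ (fun n => (blen K).+2%:R * leafProb u v n ^+ blen K)).
    move=> n; apply/andP; split; first exact: fine_ge0.
    apply: le_trans (LILI_prob_le n K u v).
    exact: le_fine_probability (mE n K) (measurable_inLILI n K u v) (E_sub n K).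
  rewrite -boundE; apply: cvgM; first exact: cvg_cst.
  exact: continuous_cvg _ (@exprn_continuous _ _ _) q_p.
apply: cvg_lim => //.
apply: (squeeze_cvgr (f := fun=> 0) (h := bound \o (fun K => blen K))).
- exact: nearW E_lim.
- exact: cvg_cst.
- exact: cvg_comp blen_cvg bound_cvg.
Qed.

Lemma LILI_prob_ge n K u v :
  (0 < K)%N -> leafProb u v n ^+ K <= fine (P n (inLILI leaf n K u v)).
Proof.
move=> K_gt0; rewrite -[X in _ ^+ X](size_iota 0 K) -prob_bigcap_inLeaf ?iota_uniq //.
apply: le_fine_probability; [exact: bigsetI_measurable | exact: measurable_inLILI |].
rewrite -bigcap_seq => w all_in; rewrite /inLILI /=.
have -> : leafCount leaf n K u v w = K.
  rewrite /leafCount -[RHS]card_ord; apply: eq_card => k; rewrite inE.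
  by apply/mem_set; apply/eqP/all_in; rewrite /mkset mem_iota add0n ltn_ord.
have : 0 < Num.sqrt (K%:R : R) by rewrite sqrtr_gt0 ltr0n.
lra.
Qed.

Lemma Plim_LILI_eq1 u v :
  leafProb u v @ \oo --> (1 : R) -> Plim P (fun n K => inLILI leaf n K u v) = 1.
Proof.
move=> q1; apply: lim_near_cst => //; exists 1%N => // K /= K_gt0.
apply: cvg_lim => //.
apply: (squeeze_cvgr (f := fun n => leafProb u v n ^+ K) (h := fun=> 1)).
- apply: nearW => n; rewrite fine_probability_le1 ?andbT; last exact: measurable_inLILI.
  exact: LILI_prob_ge.
- by rewrite -(expr1n R K); exact: continuous_cvg _ (@exprn_continuous _ _ _) q1.
- exact: cvg_cst.
Qed.

Lemma leafProbC u v : leafProb u v = leafProb v u.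
Proof. by apply/funext => n; rewrite /leafProb inLeafC. Qed.

Lemma leafProbxx u : leafProb u u = fun=> 1.
Proof. by apply/funext => n; rewrite /leafProb inLeafxx probability_setT. Qed.

Lemma cvg_leafProb_trans a b c :
  leafProb a b @ \oo --> (1 : R) -> leafProb b c @ \oo --> (1 : R) ->
  leafProb a c @ \oo --> (1 : R).
Proof.
move=> ab1 bc1.
apply: (squeeze_cvgr (f := leafProb a b + leafProb b c - fun=> 1) (h := fun=> 1)).
- apply: nearW => n; rewrite leafProb_le1 andbT /=.
  apply: le_trans (fine_probabilityI_ge _ _ _ (Hmeas _ _ _ _) (Hmeas _ _ _ _)) _.
  apply: le_fine_probability (inLeaf_trans _ _ _ _ _) => //.
  exact: measurableI.
- by rewrite -[X in _ --> X](addrK 1); apply: cvgB; [exact: cvgD | exact: cvg_cst].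
- exact: cvg_cst.
Qed.

Hypothesis Hlim : forall u v, cvg (leafProb u v @ \oo).

Lemma lim_leafProb_lt1 u v :
  ~ (leafProb u v @ \oo --> (1 : R)) -> limn (leafProb u v) < 1.
Proof.
move=> not1; rewrite lt_neqAle limr_le ?andbT //; last exact: nearW (leafProb_le1 u v).
by apply/eqP => lim1; apply: not1; rewrite -lim1; exact: Hlim.
Qed.

Lemma Plim_LILI_eq1P u v :
  Plim P (fun n K => inLILI leaf n K u v) = 1 <-> leafProb u v @ \oo --> (1 : R).
Proof.
split=> [Plim1|]; last exact: Plim_LILI_eq1.
apply: contrapT => /lim_leafProb_lt1 lt1; move: Plim1.
rewrite (Plim_LILI_sub_eq0 (Hlim u v) lt1 (fun n K => measurable_inLILI n K u v)
  (fun n K => @subset_refl _ _)) => /eqP.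
by rewrite eq_sym oner_eq0.
Qed.

End forest.

Theorem mainTheorem7 (R : realType) (dim : nat) (d : measure_display)
  (Omega : measurableType d) (Lf : eqType)
  (P : nat -> probability Omega R)
  (leaf : nat -> nat -> Omega -> 'rV[R]_dim -> Lf)
  (Hmeas : forall n k u v, measurable (inLeaf leaf n k u v))
  (Hsame : forall n k u v,
      P n (inLeaf leaf n k u v) = P n (inLeaf leaf n 0 u v))
  (Hindep : forall n u v,
      mutually_independent (P n) (fun k => inLeaf leaf n k u v))
  (Hlim : forall u v,
      cvg ((fun n => fine (P n (inLeaf leaf n 0 u v))) @ \oo))
  (x y : 'rV[R]_dim) (Hxy : x != y) :
  (Plim P (fun n K => inLILI leaf n K y x) < 1 ->
     forall w : 'rV[R]_dim,
       Plim P (fun n K => inLILI leaf n K w x `&` inLILI leaf n K w y) = 0)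
  /\
  (Plim P (fun n K => inLILI leaf n K y x) = 1 <->
     forall w : 'rV[R]_dim,
       (Plim P (fun n K => inLILI leaf n K w x) = 1 <->
        Plim P (fun n K => inLILI leaf n K w y) = 1)).
Proof.
have leafProb_cvg u v : cvg (leafProb P leaf u v @ \oo) := Hlim u v.
have cvg1P := Plim_LILI_eq1P P leaf Hmeas Hsame Hindep leafProb_cvg.
have lt1 := lim_leafProb_lt1 P leaf Hmeas leafProb_cvg.
have trans := cvg_leafProb_trans P leaf Hmeas.
split.
  move=> yx_lt1 w.
  have mI n K : measurable (inLILI leaf n K w x `&` inLILI leaf n K w y).
    exact: measurableI (measurable_inLILI leaf Hmeas n K w x)
                       (measurable_inLILI leaf Hmeas n K w y).
  have [wx|/lt1 wx] := pselect (leafProb P leaf w x @ \oo --> (1 : R)); last first.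
    exact: (Plim_LILI_sub_eq0 P leaf Hmeas Hsame Hindep (leafProb_cvg w x) wx mI
             (fun n K => @subIsetl _ _ _)).
  have [wy|/lt1 wy] := pselect (leafProb P leaf w y @ \oo --> (1 : R)); last first.
    exact: (Plim_LILI_sub_eq0 P leaf Hmeas Hsame Hindep (leafProb_cvg w y) wy mI
             (fun n K => @subIsetr _ _ _)).
  have /cvg1P yx1 : leafProb P leaf y x @ \oo --> (1 : R).
    by apply: trans wx; rewrite leafProbC.
  by move: yx_lt1; rewrite yx1 ltxx.
split=> [/cvg1P yx1 w|same].
  split=> /cvg1P w1; apply/cvg1P; first by apply: trans w1 _; rewrite leafProbC.
  exact: trans w1 yx1.
apply/cvg1P; rewrite leafProbC; apply/cvg1P/(same x).1/cvg1P.
by rewrite leafProbxx; exact: cvg_cst.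
Qed.
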